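(* Let $n\ge1$, $T>0$, and let $u_0:\mathbb{R}^n\to\mathbb{R}$ be a locally Lipschitz function defining a proper entire graph, i.e. $u_0(x)\to+\infty$ as $|x|\to+\infty$. Let $u_1,u_2:\mathbb{R}^n\times(0,T]\to\mathbb{R}$ be two smooth solutions of the graphical mean curvature flow $$u_t=\sum_{i,j=1}^n\Big(\delta^{ij}-\frac{D_iu\,D_ju}{1+|Du|^2}\Big)D_{ij}u\qquad\text{on }\mathbb{R}^n\times(0,T]$$ with the same initial data $u_0$, that is, $\lim_{t\to0}u_1(\cdot,t)=\lim_{t\to0}u_2(\cdot,t)=u_0$. Assume that there is a constant $c>0$ such that both $u=u_1$ and $u=u_2$ satisfy the lower curvature bound $$v\,h^i_j\ge -c\,\delta^i_j\qquad\text{at all points of the graph of }u(\cdot,t),\ \text{for all }t\in(0,T].$$ Then $u_1=u_2$ on $\mathbb{R}^n\times(0,T]$.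
   Context: For a smooth function $u(\cdot,t)$ on $\mathbb{R}^n$: $v=\sqrt{1+|Du|^2}$ is the gradient function of its graph, and $$h^i_j=\sum_l\Big(\delta^{il}-\frac{D_iu\,D_lu}{1+|Du|^2}\Big)\frac{D_{lj}u}{\sqrt{1+|Du|^2}}$$ is the second fundamental form (as a mixed tensor) of the graph. The inequality $v\,h^i_j\ge -c\,\delta^i_j$ is an inequality of endomorphisms that are self-adjoint with respect to the induced metric $g_{ij}=\delta_{ij}+D_iu\,D_ju$; equivalently, all principal curvatures $\lambda$ of the graph satisfy $v\lambda\ge -c$, i.e. $D_{ij}u\,\xi^i\xi^j\ge -c\,(|\xi|^2+\langle Du,\xi\rangle^2)$ for all $\xi\in\mathbb{R}^n$. The limits $\lim_{t\to0}u_i(\cdot,t)=u_0$ are understood as uniform convergence on compact subsets of $\mathbb{R}^n$. *)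

(* Defs.v *)
From mathcomp Require Import all_boot all_order all_algebra.
From mathcomp Require Import all_classical all_reals all_analysis.

Set Implicit Arguments.
Unset Strict Implicit.
Unset Printing Implicit Defensive.

Import Order.TTheory GRing.Theory Num.Theory numFieldNormedType.Exports.

Local Open Scope classical_set_scope.
Local Open Scope ring_scope.

Section EuclideanNorm.
Variables (R : realType) (n : nat).

(* The library norm `|x| on 'rV[R]_n is the sup norm. *)
Definition enorm (x : 'rV[R]_n) : R := Num.sqrt (\sum_i x 0 i ^+ 2).

Definition proper_graph (f : 'rV[R]_n -> R) : Prop :=
  forall M : R, exists r : R, forall x, r < enorm x -> M < f x.

End EuclideanNorm.

Section GraphGeometry.
Variables (R : realType) (n : nat).
Implicit Types (f : 'rV[R]_n -> R) (x : 'rV[R]_n).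

Definition partial (i : 'I_n) f x : R := 'D_(delta_mx 0 i) f x.

Definition grad f x : 'rV[R]_n := \row_i partial i f x.

Definition hess f x : 'M[R]_n := \matrix_(i, j) partial i (partial j f) x.

Definition gradient_function f x : R := Num.sqrt (1 + enorm (grad f x) ^+ 2).

Definition graph_metric f x : 'M[R]_n :=
  \matrix_(i, j) ((i == j)%:R + grad f x 0 i * grad f x 0 j).

Definition graph_metric_inv f x : 'M[R]_n :=
  \matrix_(i, l) ((i == l)%:R
    - grad f x 0 i * grad f x 0 l / (1 + enorm (grad f x) ^+ 2)).

(* h^i_j is the entry (i, j); as an endomorphism it acts on column vectors. *)
Definition second_fundamental_form f x : 'M[R]_n :=
  \matrix_(i, j) \sum_l
    graph_metric_inv f x i l * (hess f x l j / gradient_function f x).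

(* The order on endomorphisms that are self-adjoint for the bilinear form g:
   g(xi, A xi) <= g(xi, B xi) for every vector xi. *)
Definition endo_le (g A B : 'M[R]_n) : Prop :=
  forall xi : 'cV[R]_n,
    (xi^T *m g *m (A *m xi)) 0 0 <= (xi^T *m g *m (B *m xi)) 0 0.

Definition curvature_bounded_below (c : R) f : Prop :=
  forall x, endo_le (graph_metric f x) ((- c)%:M)
              (gradient_function f x *: second_fundamental_form f x).

End GraphGeometry.

Section Evolution.
Variables (R : realType) (n : nat) (T : R).
Implicit Types u : 'rV[R]_n -> R -> R.

(* Functions on R^n x (0, T] are represented by total functions whose values
   at times outside (0, T] are irrelevant. In particular the time derivative
   only looks at times in (0, T]: it is the usual one for t < T and the left
   derivative for t = T. *)
Definition time_quotient u (x : 'rV[R]_n) (t : R) : set_system R :=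
  h^-1 * (u x (t + h) - u x t)
    @[h --> within [set h | 0 < t + h <= T] 0^'].

Definition dtime u (x : 'rV[R]_n) (t : R) : R := lim (time_quotient u x t).

Definition dspace (i : 'I_n) u (x : 'rV[R]_n) (t : R) : R :=
  partial i (u^~ t) x.

Definition slab : set ('rV[R]_n * R) := [set p | 0 < p.2 <= T].

Fixpoint Ck (k : nat) u : Prop :=
  {within slab, continuous (fun p : 'rV[R]_n * R => u p.1 p.2)} /\
  (if k is k'.+1 then
     [/\ forall i x t, 0 < t <= T -> derivable (u^~ t) x (delta_mx 0 i),
         forall x t, 0 < t <= T -> cvg (time_quotient u x t),
         forall i, Ck k' (dspace i u)
       & Ck k' (dtime u)]
   else True).

Definition smooth u : Prop := forall k, Ck k u.

Definition graphical_mcf u : Prop :=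
  forall x t, 0 < t <= T ->
    dtime u x t =
      \sum_i \sum_j graph_metric_inv (u^~ t) x i j * hess (u^~ t) x i j.

Definition has_initial_data u (u0 : 'rV[R]_n -> R) : Prop :=
  {family compact, (fun t : R => u^~ t) @ 0^'+ --> u0}.

End Evolution.

(* Main.v *)
Require Import Defs.
From mathcomp Require Import all_boot all_order all_algebra.
From mathcomp Require Import all_classical all_reals all_analysis.
From mathcomp Require Import ring lra.
Import Order.TTheory GRing.Theory Num.Theory numFieldNormedType.Exports.
Local Open Scope classical_set_scope.
Local Open Scope ring_scope.

Set Implicit Arguments.
Unset Strict Implicit.

(** The theorem is a maximum principle for [exp (- u2) - exp (- u1)].  By symmetry
    it is enough to show that this function is nowhere positive.

    The difficulty is the behaviour at infinity, where nothing is known about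
    [u1] relative to [u2].  The curvature bound enters twice.  First, traced
    with the inverse metric, it bounds the speed from below: [u_t >= - c n].
    Hence [u2 >= u0 - c n T] is proper uniformly in time (mcf_lower_bound), and
    [exp (- u2) - exp (- u1) <= exp (- u2)] is small outside a compact set.  It is
    also small on compact sets at early times, since both solutions converge to
    [u0] there.  So [exp (- k t) (exp (- u2) - exp (- u1))], if positive
    somewhere, has a positive maximum over all points up to a given time, and it
    is attained at a positive time (mcf_comparison).

    Second, at such a maximum put [q = exp (u1 - u2) > 1] and [p = Du2].  The
    conditions in space are [Du1 = q p] and
    [D^2 u1 <= q D^2 u2 + q (q - 1) p^T p] (max_exp_diff).  Contract with the
    inverse metric of [u1], which depends only on [q p]; its difference with the
    inverse metric of [u2] is a multiple of [p^T p], so only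
    [D^2 u2 (p, p) >= - c |p|^2 (1 + |p|^2)] is needed to conclude that
    [d_t u1 <= q d_t u2 + (2 c + 1) (q - 1)] (touching_speed_le), with no
    dependence on [p].  With [k = 2 c + 2] the condition in time is
    [d_t u1 >= q d_t u2 + (2 c + 2) (q - 1)], a contradiction (gap_max_le0).

    This gives equality before time [T], and at time [T] by continuity. *)

(** * Contraction of quadratic forms with the inverse metric of a graph *)

Definition quad (R : realType) (n : nat) (M : 'M[R]_n) (xi : 'rV[R]_n) : R :=
  \sum_i \sum_j M i j * (xi 0 i * xi 0 j).

Definition dot (R : realType) (n : nat) (p xi : 'rV[R]_n) : R :=
  \sum_i p 0 i * xi 0 i.

(** The inverse of the metric [1 + p^T p] of a graph with gradient [p], as a
    function of the gradient alone: the comparison evaluates it at the gradient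
    of one solution and pairs it with the Hessian of the other. *)
Definition gram_inv (R : realType) (n : nat) (p : 'rV[R]_n) : 'M[R]_n :=
  \matrix_(i, l) ((i == l)%:R - p 0 i * p 0 l / (1 + dot p p)).

Definition mxdot (R : realType) (n : nat) (A M : 'M[R]_n) : R :=
  \sum_i \sum_j A i j * M i j.

Section Algebra.
Variables (R : realType) (n : nat).
Implicit Types (p xi : 'rV[R]_n) (M A : 'M[R]_n).

Lemma dot_ge0 p : 0 <= dot p p.
Proof. by apply: sumr_ge0 => i _; rewrite -expr2 sqr_ge0. Qed.

Lemma dotZ (q : R) p : dot (q *: p) (q *: p) = q ^+ 2 * dot p p.
Proof. by rewrite mulr_sumr; apply: eq_bigr => i _; rewrite !mxE; ring. Qed.

Lemma enorm_sqr p : enorm p ^+ 2 = dot p p.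
Proof.
rewrite /enorm sqr_sqrtr; last by apply: sumr_ge0 => i _; exact: sqr_ge0.
by apply: eq_bigr => i _; rewrite expr2.
Qed.

Lemma graph_metric_invE (f : 'rV[R]_n -> R) x :
  graph_metric_inv f x = gram_inv (grad f x).
Proof. by apply/matrixP => i j; rewrite !mxE enorm_sqr. Qed.

Lemma mul_row_tr p : p *m p^T = (dot p p)%:M.
Proof.
apply/matrixP => i j; rewrite !ord1 !mxE mulr1n.
by apply: eq_bigr => k _; rewrite !mxE.
Qed.

Lemma quadE M xi : quad M xi = (xi *m M *m xi^T) 0 0.
Proof.
rewrite mxE /quad exchange_big; apply: eq_bigr => j _ /=.
by rewrite !mxE mulr_suml; apply: eq_bigr => i _; ring.
Qed.

Lemma quadZ M q xi : quad M (q *: xi) = q ^+ 2 * quad M xi.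
Proof.
rewrite mulr_sumr; apply: eq_bigr => i _; rewrite mulr_sumr.
by apply: eq_bigr => j _; rewrite !mxE; ring.
Qed.

Lemma mxdot_gram_inv p M :
  mxdot (gram_inv p) M = \tr M - quad M p / (1 + dot p p).
Proof.
rewrite /quad mulr_suml -sumrB; apply: eq_bigr => i _.
rewrite mulr_suml.
transitivity (\sum_j ((i == j)%:R * M i j -
    M i j * (p 0 i * p 0 j) / (1 + dot p p))).
  by apply: eq_bigr => j _; rewrite !mxE; ring.
rewrite sumrB; congr (_ - _).
rewrite (bigD1 i)//= eqxx mul1r big1 ?addr0// => j ji.
by rewrite eq_sym (negbTE ji) mul0r.
Qed.

(** With [v^2 = 1 + |p|^2], the matrix [1 - p^T p / v^2] is the square of the
    symmetric matrix [A = 1 - p^T p / (v (v + 1))], so its pairing with [M] is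
    the trace of [A M A], a sum of values of the quadratic form of [M]. *)
Lemma mxdot_gram_inv_le0 p M :
  (forall xi, quad M xi <= 0) -> mxdot (gram_inv p) M <= 0.
Proof.
move=> M0; have P0 := dot_ge0 p; set v := Num.sqrt (1 + dot p p).
have v2 : v ^+ 2 = 1 + dot p p by rewrite sqr_sqrtr// addr_ge0.
have v0 : 0 < v by rewrite sqrtr_gt0 ltr_wpDr.
pose a := (v * (v + 1))^-1.
pose A : 'M[R]_n := 1%:M - a *: (p^T *m p).
have AA : A *m A = 1%:M - (2 * a - a ^+ 2 * dot p p) *: (p^T *m p).
  have QQ : (p^T *m p) *m (p^T *m p) = dot p p *: (p^T *m p).
    by rewrite !mulmxA -(mulmxA _ p p^T) mul_row_tr mul_mx_scalar -scalemxAl.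
  rewrite /A; move: (p^T *m p) QQ => Q QQ.
  rewrite mulmxBl mul1mx mulmxBr mulmx1 -scalemxAl -scalemxAr QQ.
  by apply/matrixP => i j; rewrite !mxE; ring.
have aE : 2 * a - a ^+ 2 * dot p p = (1 + dot p p)^-1.
  rewrite -v2 (_ : dot p p = v ^+ 2 - 1); last by rewrite v2; ring.
  by rewrite /a; field; rewrite !gt_eqF// addr_gt0.
have AT : A^T = A.
  by rewrite /A linearB linearZ /= trmx_mul trmxK trmx1.
suff -> : mxdot (gram_inv p) M = \sum_k quad M (row k A).
  by apply: sumr_le0 => k _; exact: M0.
have -> : \sum_k quad M (row k A) = \tr (A *m M *m A).
  apply: eq_bigr => k _; rewrite quadE -{4}AT -row_mul !mxE.
  by apply: eq_bigr => j _; rewrite !mxE.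
rewrite mxtrace_mulC mulmxA AA aE mxdot_gram_inv mulmxBl mul1mx linearB /=.
congr (_ - _); rewrite -scalemxAl linearZ /= mulrC; congr (_ * _).
rewrite quadE mxtrace_mulC mulmxA mxtrace_mulC.
by rewrite /mxtrace big_ord1 mulmxA.
Qed.

Lemma quadD A M xi : quad (A + M) xi = quad A xi + quad M xi.
Proof. by rewrite !quadE mulmxDr mulmxDl mxE. Qed.

Lemma quad_scale a M xi : quad (a *: M) xi = a * quad M xi.
Proof. by rewrite !quadE -scalemxAr -scalemxAl mxE. Qed.

Lemma quad1 xi : quad 1%:M xi = dot xi xi.
Proof.
by rewrite quadE mulmx1 mxE; apply: eq_bigr => i _; rewrite !mxE.
Qed.

Lemma quad_outer p xi : quad (p^T *m p) xi = dot p xi ^+ 2.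
Proof.
rewrite /quad expr2 {1}/dot mulr_suml; apply: eq_bigr => i _.
rewrite /dot mulr_sumr; apply: eq_bigr => j _.
by rewrite !mxE big_ord1 !mxE; ring.
Qed.

Lemma tr_outer p : \tr (p^T *m p) = dot p p.
Proof.
by rewrite mxtrace_mulC /mxtrace big_ord1 mxE; apply: eq_bigr => i _; rewrite !mxE.
Qed.

Lemma mxdotDr A M N : mxdot A (M + N) = mxdot A M + mxdot A N.
Proof.
rewrite /mxdot -big_split; apply: eq_bigr => i _ /=; rewrite -big_split.
by apply: eq_bigr => j _; rewrite !mxE mulrDr.
Qed.

Lemma mxdotZr A a M : mxdot A (a *: M) = a * mxdot A M.
Proof.
rewrite /mxdot mulr_sumr; apply: eq_bigr => i _; rewrite mulr_sumr.
by apply: eq_bigr => j _; rewrite !mxE mulrCA.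
Qed.

Lemma mxdot_gram_inv_le p M N : (forall xi, quad M xi <= quad N xi) ->
  mxdot (gram_inv p) M <= mxdot (gram_inv p) N.
Proof.
move=> MN; rewrite -subr_le0 -mulN1r -mxdotZr -mxdotDr.
apply: mxdot_gram_inv_le0 => xi.
by rewrite quadD quad_scale mulN1r subr_le0.
Qed.

(** The curvature bound says that the Hessian is at least [- c] times the metric,
    and the metric paired with its own inverse gives the dimension. *)
Lemma curvature_bound_speed (c : R) p M :
  (forall xi, - c * (dot xi xi + dot p xi ^+ 2) <= quad M xi) ->
  - c * n%:R <= mxdot (gram_inv p) M.
Proof.
move=> cM; have P0 := dot_ge0 p.
have -> : - c * n%:R = mxdot (gram_inv p) (- c *: (1%:M + p^T *m p)).
  rewrite mxdotZr mxdotDr !mxdot_gram_inv mxtrace1 quad1 tr_outer.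
  by rewrite quad_outer; congr (_ * _); field; rewrite gt_eqF// ltr_wpDr.
apply: mxdot_gram_inv_le => xi.
by rewrite quad_scale quadD quad1 quad_outer.
Qed.

(** This is where the curvature bound enters the comparison.  With [P = |p|^2],
    steepening the gradient from [p] to [q p] replaces [N p p / (1 + P)] by
    [q^2 N p p / (1 + q^2 P)] in the speed of [N]; by the lower bound on [N p p]
    the speed increases by at most
    [c P (q^2 - 1) / (1 + q^2 P) <= c (q^2 - 1) / q^2], that is, after
    multiplication by [q], by at most [2 c (q - 1)].  The rank one term adds
    [q (q - 1) P / (1 + q^2 P) <= q - 1].  Both bounds are uniform in [P]. *)
Lemma touching_speed_le (c q : R) p M N : 0 <= c -> 1 <= q ->
  (forall xi, - c * (dot xi xi + dot p xi ^+ 2) <= quad N xi) ->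
  (forall xi, quad M xi <= q * quad N xi + q * (q - 1) * dot p xi ^+ 2) ->
  mxdot (gram_inv (q *: p)) M
    <= q * mxdot (gram_inv p) N + (2 * c + 1) * (q - 1).
Proof.
move=> c0 q1 cN MN; have P0 := dot_ge0 p.
apply: (@le_trans _ _ (mxdot (gram_inv (q *: p))
    (q *: N + (q * (q - 1)) *: (p^T *m p)))).
  apply: mxdot_gram_inv_le => xi.
  by rewrite quadD !quad_scale quad_outer.
have := cN p; rewrite mxdotDr !mxdotZr !mxdot_gram_inv !quadZ dotZ.
rewrite tr_outer quad_outer.
move: (dot p p) (quad N p) (\tr N) P0 => P m t P0 mP.
have q0 : 0 < q by rewrite (lt_le_trans _ q1).
have D0 : 0 < 1 + q ^+ 2 * P by rewrite ltr_wpDr// mulr_ge0// sqr_ge0.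
have E0 : 0 < 1 + P by rewrite ltr_wpDr.
rewrite -subr_ge0.
(* Over the common denominator every term of the difference is visibly
   nonnegative; [m + c (P + P^2)] is, by the curvature bound in direction [p]. *)
have -> : q * (t - m / (1 + P)) + (2 * c + 1) * (q - 1) -
    (q * (t - q ^+ 2 * m / (1 + q ^+ 2 * P)) +
     q * (q - 1) * (P - q ^+ 2 * P ^+ 2 / (1 + q ^+ 2 * P))) =
   (q - 1) * (q * (q + 1) * (m + c * (P + P ^+ 2)) +
     (1 + P) * (c * (2 + q * (q - 1) * P) + (1 + q * (q - 1) * P))) /
   ((1 + P) * (1 + q ^+ 2 * P)).
  by field; rewrite !gt_eqF.
have q10 : 0 <= q - 1 by rewrite subr_ge0.
apply: divr_ge0; last by rewrite mulr_ge0// ltW.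
apply: mulr_ge0 => //; apply: addr_ge0.
  by apply: mulr_ge0; [rewrite mulr_ge0//; lra|lra].
have qP : 0 <= q * (q - 1) * P by rewrite !mulr_ge0// ltW.
by apply: mulr_ge0; [lra|apply: addr_ge0; [rewrite mulr_ge0//; lra|lra]].
Qed.

(** Lowering an index of the mixed tensor [v h] with the metric gives the
    Hessian. *)
Lemma curvature_bound_hess (c : R) (f : 'rV[R]_n -> R) :
  curvature_bounded_below c f -> forall x xi,
  - c * (dot xi xi + dot (grad f x) xi ^+ 2) <= quad (hess f x) xi.
Proof.
move=> cf x xi; have := cf x (xi^T).
set p := grad f x.
have P0 := dot_ge0 p.
have v2 : gradient_function f x ^+ 2 = 1 + dot p p.
  by rewrite sqr_sqrtr enorm_sqr// addr_ge0.
have v0 : 0 < gradient_function f x.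
  by rewrite sqrtr_gt0 enorm_sqr ltr_wpDr.
have gE : graph_metric f x = 1%:M + p^T *m p.
  by apply/matrixP => i j; rewrite !mxE big_ord1 !mxE.
have giE : graph_metric_inv f x = 1%:M - (1 + dot p p)^-1 *: (p^T *m p).
  by apply/matrixP => i j; rewrite !mxE big_ord1 enorm_sqr !mxE; ring.
have ggi : graph_metric f x *m graph_metric_inv f x = 1%:M.
  rewrite gE giE mulmxBr mulmx1 -scalemxAr mulmxDl mul1mx.
  rewrite mulmxA -(mulmxA _ p p^T) mul_row_tr mul_mx_scalar -scalemxAl.
  rewrite -[X in X + dot p p *: _]scale1r -scalerDl scalerA.
  by rewrite mulVf ?scale1r ?addrK// gt_eqF// ltr_wpDr.
have SE : gradient_function f x *: second_fundamental_form f x =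
    graph_metric_inv f x *m hess f x.
  apply/matrixP => i j; rewrite mxE mxE [RHS]mxE mulr_sumr; apply: eq_bigr => l _.
  rewrite mulrCA; congr (_ * _).
  by rewrite mulrC divfK// gt_eqF.
rewrite SE trmxK.
have -> : xi *m graph_metric f x *m (graph_metric_inv f x *m hess f x *m xi^T) =
    xi *m hess f x *m xi^T.
  by rewrite !mulmxA -(mulmxA xi) ggi mulmx1.
rewrite quadE => h; apply: le_trans h.
rewrite mul_scalar_mx -scalemxAr mxE gE mulmxDr mulmx1 mulmxDl mxE le_eqVlt.
apply/orP; left; apply/eqP; congr (_ * (_ + _)).
  by rewrite mxE; apply: eq_bigr => i _; rewrite !mxE.
by rewrite -quadE quad_outer.
Qed.
End Algebra.

(** * Derivatives along lines and conditions at a maximum *)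

Section Calculus.
Variable R : realType.

Lemma mvt_from0 (f df : R -> R) (a : R) : (forall s, is_derive s (1 : R) f (df s)) ->
  exists2 th, `|th| <= `|a| & f a - f 0 = a * df th.
Proof.
move=> fdf.
have cf (A : set R) : {within A, continuous f}.
  apply: continuous_subspaceT => s.
  by apply/differentiable_continuous/derivable1_diffP; have [] := fdf s.
have [a0|a0] := leP 0 a.
  have [th] := MVT_segment a0 (fun s _ => fdf s) (cf _).
  rewrite in_itv /= => /andP[th0 tha] ->; exists th; last by rewrite subr0 mulrC.
  by rewrite !ger0_norm.
have [th] := MVT_segment (ltW a0) (fun s _ => fdf s) (cf _).
rewrite in_itv /= => /andP[th0 tha] e; exists th.
  by rewrite ler0_norm// ltr0_norm// lerN2.
by rewrite -[LHS]opprB e; ring.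
Qed.

Lemma is_derive_line (V : normedModType R) (g : V -> R) (x v : V) :
  (forall z, derivable g z v) ->
  forall s, is_derive s (1 : R) (fun s => g (x + s *: v)) ('D_v g (x + s *: v)).
Proof.
move=> dg s.
have E : (fun h : R => h^-1 *: (((fun s => g (x + s *: v)) \o shift s) (h *: (1 : R))
      - g (x + s *: v))) =
    (fun h : R => h^-1 *: ((g \o shift (x + s *: v)) (h *: v) - g (x + s *: v))).
  apply/funext => h /=; rewrite [h *: 1]mulr1 scalerDl addrCA.
  by rewrite addrC.
by split; [rewrite /derivable E; exact: dg|rewrite /derive E].
Qed.

(** Strict differentiability of [g] at [y] in the single direction [v]: the base
    point [w] is allowed to vary.  Unlike plain directional differentiability,
    this is additive in [v], which is how continuous partial derivatives give
    all directional derivatives. *)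
Definition strict_derivative (V : normedModType R) (g : V -> R) (y v : V) (l : R) :=
  forall e, 0 < e -> exists2 d, 0 < d & forall w (a : R), `|w - y| < d -> `|a| < d ->
    `|g (w + a *: v) - g w - a * l| <= e * `|a|.

Lemma strict_derivative_C1 (V : normedModType R) (g : V -> R) (y v : V) :
  (forall z, derivable g z v) -> {for y, continuous ('D_v g)} ->
  strict_derivative g y v ('D_v g y).
Proof.
move=> dg cg e e0.
have /cvgrPdist_le /(_ _ e0) /nbhs_ballP[d /= d0 dP] := cg.
have v1 : 0 < 2 + `|v| by rewrite ltr_wpDr.
(* The mean value theorem evaluates the derivative at a point at distance at most
   [|w - y| + |a| |v|] from [y], which is less than [d] for this radius. *)
have r0 : 0 < d / (2 + `|v|) by rewrite divr_gt0.
have rd : d / (2 + `|v|) * (2 + `|v|) = d by rewrite divfK// gt_eqF.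
exists (d / (2 + `|v|)) => // w a wy ad.
have [th tha] := mvt_from0 a (is_derive_line w dg).
rewrite scale0r addr0 => ->; rewrite -mulrBr normrM mulrC ler_wpM2r//.
rewrite distrC; apply: dP; rewrite -ball_normE /=.
rewrite distrC addrAC (le_lt_trans (ler_normD _ _))// normrZ.
have tv : `|th| * `|v| <= d / (2 + `|v|) * `|v|.
  by rewrite ler_wpM2r// (le_trans tha)// ltW.
by move: rd; rewrite mulrDr; lra.
Qed.

Lemma strict_derivative0 (V : normedModType R) (g : V -> R) (y : V) :
  strict_derivative g y 0 0.
Proof.
move=> e e0; exists 1 => // w a _ _.
by rewrite scaler0 addr0 subrr mulr0 subr0 normr0 mulr_ge0// ltW.
Qed.

Lemma strict_derivativeZ (V : normedModType R) (g : V -> R) (y v : V) (k l : R) :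
  strict_derivative g y v l -> strict_derivative g y (k *: v) (k * l).
Proof.
move=> gl e e0; have k1 : 0 < 1 + `|k| by rewrite ltr_wpDr.
have e'0 : 0 < e / (1 + `|k|) by rewrite divr_gt0.
have [d d0 dP] := gl _ e'0.
exists (d / (1 + `|k|)); first by rewrite divr_gt0.
move=> w a wy; rewrite ltr_pdivlMr// => ad.
rewrite scalerA mulrA; apply: le_trans (dP _ _ _ _) _.
- by rewrite (lt_le_trans wy)// ler_pdivrMr// ler_peMr ?(ltW d0)// lerDl.
- by rewrite normrM; have := normr_ge0 a; move: ad; rewrite mulrDr; lra.
rewrite normrM mulrA mulrAC ler_wpM2r// mulrAC ler_pdivrMr// ler_pM2l//.
by rewrite lerDr.
Qed.

(** Go from [w] to [w + a v1 + a v2] in two steps; the second one starts from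
    [w + a v1], whence the need for a moving base point. *)
Lemma strict_derivativeD (V : normedModType R) (g : V -> R) (y v1 v2 : V) (l1 l2 : R) :
  strict_derivative g y v1 l1 -> strict_derivative g y v2 l2 ->
  strict_derivative g y (v1 + v2) (l1 + l2).
Proof.
move=> g1 g2 e e0; have e'0 : 0 < e / 2 by rewrite divr_gt0.
have v1P : 0 < 1 + `|v1| by rewrite ltr_wpDr.
have [d1 d10 d1P] := g1 _ e'0; have [d2 d20 d2P] := g2 _ e'0.
exists (Num.min d1 (d2 / (1 + `|v1|))); first by rewrite lt_min d10 divr_gt0.
move=> w a; rewrite !lt_min !ltr_pdivlMr// => /andP[w1 w2] /andP[a1 a2].
have h1 := d1P _ _ w1 a1.
have h2 : `|g (w + a *: v1 + a *: v2) - g (w + a *: v1) - a * l2| <= e / 2 * `|a|.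
  apply: d2P.
    rewrite addrAC (le_lt_trans (ler_normD _ _))// normrZ.
    have [aw|/ltW wa] := leP `|a| `|w - y|.
      move: w2; rewrite mulrDr mulr1; apply: le_lt_trans.
      by rewrite lerD2l ler_wpM2r.
    move: a2; rewrite mulrDr mulr1; apply: le_lt_trans.
    by rewrite lerD2r.
  by apply: le_lt_trans a2; rewrite ler_peMr// lerDl.
rewrite (splitr e) mulrDl scalerDr addrA.
apply: le_trans (lerD h1 h2); apply: le_trans (ler_normD _ _).
by rewrite le_eqVlt; apply/orP; left; apply/eqP; congr `|_|; ring.
Qed.

Lemma strict_derivative_is_derive (V : normedModType R) (g : V -> R) (y v : V) (l : R) :
  strict_derivative g y v l -> is_derive y v g l.
Proof.
move=> gl.
suff h : h^-1 *: ((g \o shift y) (h *: v) - g y) @[h --> (0 : R)^'] --> l.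
  by split; [apply/cvg_ex; exists l|exact: cvg_lim h].
apply/cvgrPdist_le => e e0; have [d d0 dP] := gl _ e0.
near=> h.
have hn : h != 0 by near: h; exact: nbhs_dnbhs_neq.
have hd : `|h| < d by near: h; apply: dnbhs0_lt.
have := dP y h; rewrite subrr normr0 => /(_ d0 hd).
rewrite /= [h *: v + y]addrC -ler_pdivrMr ?normr_gt0// -normfV -normrM distrC.
apply: le_trans.
rewrite le_eqVlt; apply/orP; left; apply/eqP; congr `|_|.
by rewrite [_ *: _]mulrC; field.
Unshelve. all: by end_near. Qed.

Lemma second_derivative_test (f df : R -> R) (l : R) :
  (forall s, is_derive s (1 : R) f (df s)) -> is_derive 0 (1 : R) df l ->
  (forall s, f s <= f 0) -> df 0 = 0 /\ l <= 0.
Proof.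
move=> fdf [ddf ldf] fmax.
have df0 : df 0 = 0.
  have f'0 : is_derive (0 : R) (1 : R) f 0.
    apply: (@derive1_at_max _ f (-1) 1); rewrite ?in_itv/=; first lra.
    - by move=> s _; have [] := fdf s.
    - by apply/andP; split; lra.
    - by move=> s _; exact: fmax.
  by rewrite -(@derive_val _ _ _ _ _ _ _ (fdf 0)) (@derive_val _ _ _ _ _ _ _ f'0).
split=> //; rewrite leNgt; apply/negP => l0.
have /cvgrPdist_lt /(_ _ l0) : h^-1 *: ((df \o shift 0) (h *: (1 : R)) - df 0)
    @[h --> (0 : R)^'] --> l by rewrite -ldf.
move=> [d /= d0 dP].
have d20 : 0 < d / 2 by rewrite divr_gt0.
have cf : {within `[0, d / 2], continuous f}.
  apply: continuous_subspaceT => s.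
  by apply/differentiable_continuous/derivable1_diffP; have [] := fdf s.
have [s] := MVT d20 (fun s _ => fdf s) cf.
rewrite in_itv /= => /andP[s0 sd] e.
have := dP s; rewrite /= sub0r normrN gtr0_norm// => /(_ _ _).
rewrite df0 addr0 [s *: 1]mulr1 subr0 => /(_ _ (lt0r_neq0 s0)).
have sd' : s < d by lra.
move=> /(_ sd') h.
have dfs : 0 < df s.
  have : 0 < s^-1 * df s.
    by move: h; rewrite ltr_norml => /andP[_]; rewrite ltrBlDr ltrDl.
  by rewrite pmulr_rgt0// invr_gt0.
have := fmax (d / 2); rewrite -subr_le0 e subr0 leNgt.
by rewrite mulr_gt0.
Qed.

Lemma left_max_derive_ge0 (f : R -> R) (a t l : R) : is_derive t (1 : R) f l ->
  a < t -> (forall s, a < s < t -> f s <= f t) -> 0 <= l.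
Proof.
move=> [dft ldf] at0 fmax; rewrite leNgt; apply/negP => l0.
have nl0 : 0 < - l by rewrite oppr_gt0.
have /cvgrPdist_lt /(_ _ nl0) : h^-1 *: ((f \o shift t) (h *: (1 : R)) - f t)
    @[h --> (0 : R)^'] --> l by rewrite -ldf.
move=> [d /= d0 dP].
pose h := Num.min (d / 2) ((t - a) / 2).
have h0 : 0 < h by rewrite lt_min !divr_gt0// subr_gt0.
have hd : h < d.
  by rewrite gt_min; apply/orP; left; rewrite ltr_pdivrMr// ltr_pMr// ltr1n.
have ha : h < t - a.
  rewrite gt_min; apply/orP; right.
  by rewrite ltr_pdivrMr// ltr_pMr ?subr_gt0// ltr1n.
have := dP (- h); rewrite /= sub0r opprK gtr0_norm// oppr_eq0 => /(_ hd).
move=> /(_ (lt0r_neq0 h0)).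
rewrite [(- h)%:A]mulr1 invrN scaleNr opprK => H.
have : f (- h + t) <= f t.
  by apply: fmax; apply/andP; split; lra.
rewrite -subr_le0 => ft.
have : h^-1 * (f (- h + t) - f t) <= 0 by rewrite mulr_ge0_le0// invr_ge0 ltW.
by move: H; rewrite ltr_norml /GRing.scale /= => /andP[+ _]; lra.
Qed.

Variable n : nat.
Implicit Types (g : 'rV[R]_n -> R).

Lemma C1_is_derive g x xi : (forall i z, derivable g z (delta_mx 0 i)) ->
  (forall i, continuous (partial i g)) ->
  is_derive x xi g (dot (grad g x) xi).
Proof.
move=> dg cg; apply: strict_derivative_is_derive.
rewrite [X in strict_derivative _ _ X](row_sum_delta xi) /dot.
apply: (big_ind2 (fun v l => strict_derivative g x v l)).
- exact: strict_derivative0.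
- by move=> *; exact: strict_derivativeD.
- move=> i _; rewrite mulrC mxE; apply: strict_derivativeZ.
  by apply: strict_derivative_C1 => //; exact: cg.
Qed.

Lemma C1_line g x xi : (forall i z, derivable g z (delta_mx 0 i)) ->
  (forall i, continuous (partial i g)) ->
  forall s, is_derive s (1 : R) (fun s => g (x + s *: xi))
    (dot (grad g (x + s *: xi)) xi).
Proof.
move=> dg cg s.
have H z := C1_is_derive z xi dg cg.
rewrite -(@derive_val _ _ _ _ _ _ _ (H (x + s *: xi))).
by apply: is_derive_line => z; have [] := H z.
Qed.

Definition twice_continuously_derivable g :=
  [/\ forall i z, derivable g z (delta_mx 0 i),
      forall i, continuous (partial i g),
      forall i j z, derivable (partial i g) z (delta_mx 0 j)
    & forall i j, continuous (partial j (partial i g))].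

Lemma C2_line g x xi : twice_continuously_derivable g ->
  forall s, is_derive s (1 : R) (fun s => dot (grad g (x + s *: xi)) xi)
    (quad (hess g (x + s *: xi)) xi).
Proof.
move=> [_ _ d2g c2g] s.
have -> : (fun s => dot (grad g (x + s *: xi)) xi) =
    \sum_i (xi 0 i \*: (fun s => partial i g (x + s *: xi))).
  apply/funext => r; rewrite fct_sumE; apply: eq_bigr => i _.
  by rewrite mxE mulrC.
apply: (@is_derive_eq _ _ _ _ _ _ _
  (\sum_i xi 0 i *: dot (grad (partial i g) (x + s *: xi)) xi)).
  apply: is_derive_sum => i; apply: is_deriveZ.
  by apply: C1_line => *; [exact: d2g|exact: c2g].
rewrite /quad exchange_big; apply: eq_bigr => i _.
rewrite /dot scaler_sumr; apply: eq_bigr => j _.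
by rewrite !mxE [_ *: _]mulrC -mulrA.
Qed.

Lemma is_derive_expN (f : R -> R) (s l : R) : is_derive s (1 : R) f l ->
  is_derive s (1 : R) (fun s => expR (- f s)) (- (l * expR (- f s))).
Proof.
move=> fl; rewrite -mulNr mulrC.
exact: (@is_derive1_comp _ expR (fun s => - f s)).
Qed.

Lemma is_derive_expN2 (f df : R -> R) (s l : R) :
  is_derive s (1 : R) f (df s) -> is_derive s (1 : R) df l ->
  is_derive s (1 : R) (fun s => - (df s * expR (- f s)))
    ((df s ^+ 2 - l) * expR (- f s)).
Proof.
move=> fdf dfl.
have H : is_derive s (1 : R) (fun s => - (df s * expR (- f s))) _ :=
  is_deriveN (is_deriveM dfl (is_derive_expN fdf)).
by apply: (is_derive_eq H); rewrite /GRing.scale /=; ring.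
Qed.

Lemma touching_conditions (e q d1 d2 h1 h2 : R) : 0 < e ->
  - (d2 * (q * e)) - - (d1 * e) = 0 ->
  (d2 ^+ 2 - h2) * (q * e) - (d1 ^+ 2 - h1) * e <= 0 ->
  d1 = q * d2 /\ h1 <= q * h2 + q * (q - 1) * d2 ^+ 2.
Proof.
move=> e0 eq1 le2.
have d1E : d1 = q * d2.
  apply: (mulIf (lt0r_neq0 e0)); apply/eqP; rewrite -subr_eq0 -eq1.
  by apply/eqP; ring.
split=> //; rewrite -subr_le0 -(ler_pM2r e0) mul0r; apply: le_trans le2.
by rewrite d1E le_eqVlt; apply/orP; left; apply/eqP; ring.
Qed.

(** At a maximum of [exp (- g2) - exp (- g1)], with value [m], the graph of [g1]
    touches from below that of [f (g2)], where [exp (- f s) = exp (- s) - m]; at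
    the contact point [f' = q] and [f'' = q (q - 1)].  Along a line through
    [x] this is the second derivative test. *)
Lemma max_exp_diff g1 g2 x :
  twice_continuously_derivable g1 -> twice_continuously_derivable g2 ->
  (forall y, expR (- g2 y) - expR (- g1 y) <= expR (- g2 x) - expR (- g1 x)) ->
  let q := expR (g1 x - g2 x) in
  grad g1 x = q *: grad g2 x /\
  forall xi, quad (hess g1 x) xi <=
    q * quad (hess g2 x) xi + q * (q - 1) * dot (grad g2 x) xi ^+ 2.
Proof.
move=> C1 C2 xmax q.
have D1 g xi (Cg : twice_continuously_derivable g) s :=
  let: And4 d c _ _ := Cg in is_derive_expN (C1_line x xi d c s).
have D2 g xi (Cg : twice_continuously_derivable g) s :=
  let: And4 d c _ _ := Cg in
  is_derive_expN2 (C1_line x xi d c s) (C2_line x xi Cg s).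
have key xi := second_derivative_test
  (fun s => is_deriveB (D1 _ xi C2 s) (D1 _ xi C1 s))
  (is_deriveB (D2 _ xi C2 0) (D2 _ xi C1 0)).
have {}key xi :
    dot (grad g1 x) xi = q * dot (grad g2 x) xi /\
    quad (hess g1 x) xi <=
    q * quad (hess g2 x) xi + q * (q - 1) * dot (grad g2 x) xi ^+ 2.
  have [] := key xi.
    move=> s; rewrite !fctE scale0r addr0; exact: xmax.
  rewrite scale0r addr0.
  have -> : expR (- g2 x) = q * expR (- g1 x).
    by rewrite /q -expRD; congr expR; ring.
  exact/touching_conditions/expR_gt0.
split; last by move=> xi; have [] := key xi.
apply/rowP => i; have [+ _] := key (delta_mx 0 i).
have de p : dot p (delta_mx 0 i : 'rV[R]_n) = p 0 i.
  rewrite /dot (bigD1 i)//= mxE !eqxx mulr1 big1 ?addr0// => j ji.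
  by rewrite mxE eqxx (negbTE ji) mulr0.
by rewrite !de => ->; rewrite !mxE.
Qed.

End Calculus.

(** * Smooth solutions of the flow *)

Section Flow.
Variables (R : realType) (n : nat) (T : R).
Implicit Types (u : 'rV[R]_n -> R -> R) (x : 'rV[R]_n) (t : R).

Lemma Ck0_slice u t : 0 < t <= T -> Ck T 0 u -> continuous (u^~ t).
Proof.
move=> tT [/subspace_continuousP cu _] x.
have /= := cu (x, t) tT => cxt.
apply/(@cvgrPdist_lt _ _ _ _ (nbhs_filter x)) => e e0.
have /cvgrPdist_lt /(_ _ e0) := cxt.
rewrite near_withinE => -[[A B] [nA nB] AB].
have {}nA : nbhs x A := nA.
apply: (@filterS _ _ (nbhs_filter x) _ _ _ nA) => y Ay.
by have := AB (y, t); apply => //; split => //=; exact: nbhs_singleton.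
Qed.

Lemma Ck0_left_limit u x : 0 < T -> Ck T 0 u -> u x s @[s --> T^'-] --> u x T.
Proof.
move=> T0 [/subspace_continuousP cu _].
have Txt : slab T (x, T) by rewrite /slab /= T0 lexx.
have /= cxT := cu (x, T) Txt.
apply/cvgrPdist_lt => e e0.
have /cvgrPdist_lt /(_ _ e0) := cxT.
rewrite near_withinE => -[[A B] [nA nB] AB].
have {}nB : nbhs T B := nB.
near=> s.
have Bs : B s by near: s; exact: (cvg_within _ nB).
have s0 : 0 < s by near: s; exact: nbhs_left_gt.
have sT : s < T by near: s; exact: nbhs_left_lt.
have := AB (x, s); apply; first by split => //; exact: nbhs_singleton.
by rewrite /slab /= s0 ltW.
Unshelve. all: by end_near. Qed.

Lemma CkS k u : Ck T k.+1 u -> Ck T 0 u.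
Proof. by move=> []. Qed.

Lemma smooth_slice u t : smooth T u -> 0 < t <= T ->
  twice_continuously_derivable (u^~ t).
Proof.
move=> su tT; have [_ [du _ c1 _]] := su 2%N.
split=> [i x|i|i j x|i j].
- exact: du.
- by have h := @CkS 0 _ (c1 i); exact: (Ck0_slice tT h).
- by have [_ [d1 _ _ _]] := c1 i; exact: d1.
- by have [_ [_ _ c2 _]] := c1 i; exact: (Ck0_slice tT (c2 j)).
Qed.

(** Before the final time both one-sided increments are admissible, so the limit
    of the quotients restricted to (0, T] is the two-sided derivative. *)
Lemma smooth_is_derive u x t : smooth T u -> 0 < t < T ->
  is_derive t (1 : R) (u x) (dtime T u x t).
Proof.
move=> su /andP[t0 tT]; have [_ [_ cu _ _]] := su 1%N.
have tT' : 0 < t <= T by rewrite t0 ltW.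
have {}cu : time_quotient T u x t --> dtime T u x t := cu x t tT'.
suff h : h^-1 *: ((u x \o shift t) (h *: (1 : R)) - u x t) @[h --> (0 : R)^']
    --> dtime T u x t.
  by split; [apply/cvg_ex; eexists; exact: h|exact: cvg_lim h].
move=> A /cu; rewrite /= /nbhs /= /fmap /=.
have near0 : \forall h \near (0 : R)^', 0 < t + h <= T.
  near=> h.
  have : `|h| < t by near: h; exact: dnbhs0_lt.
  have : `|h| < T - t by near: h; apply: dnbhs0_lt; rewrite subr_gt0.
  rewrite !ltr_norml => /andP[_ h1] /andP[h2 _].
  by apply/andP; split; lra.
move=> H; near=> h.
have tTh : 0 < t + h <= T by near: h.
have : (0 < t + h <= T) -> A (h^-1 * (u x (t + h) - u x t)) by near: h; exact: H.
by move=> /(_ tTh); rewrite /= [h%:A]mulr1 [h + t]addrC.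
Unshelve. all: by end_near. Qed.

Lemma mcf_dtime u x t : graphical_mcf T u -> 0 < t <= T ->
  dtime T u x t = mxdot (gram_inv (grad (u^~ t) x)) (hess (u^~ t) x).
Proof. by move=> mu tT; rewrite mu// graph_metric_invE. Qed.

Variable c : R.

Lemma mcf_speed_ge u x t : graphical_mcf T u -> 0 < t <= T ->
  curvature_bounded_below c (u^~ t) -> - c * n%:R <= dtime T u x t.
Proof.
move=> mu tT cu; rewrite mcf_dtime//.
by apply: curvature_bound_speed => xi; exact: curvature_bound_hess.
Qed.

Lemma initial_data_uniform u (u0 : 'rV[R]_n -> R) (K : set 'rV[R]_n) (e : R) :
  has_initial_data u u0 -> compact K -> 0 < e ->
  \forall t \near (0 : R)^'+, forall x, K x -> `|u0 x - u x t| < e.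
Proof.
move=> iu cK e0.
have /fam_cvgP /(_ K cK) h := iu.
have := h [set f | forall x, K x -> `|u0 x - f x| < e].
apply; apply/uniform_nbhs.
exists [set p : R * R | `|p.1 - p.2| < e]; split; last by [].
exact: (@entourage_ball _ R (PosNum e0)).
Qed.

(** The speed is at least [- c n], so [u + c n t] is nondecreasing in time.  If
    the initial graph is proper, the solution is proper uniformly in time. *)
Lemma mcf_lower_bound u (u0 : 'rV[R]_n -> R) x t :
  0 <= c -> smooth T u -> graphical_mcf T u -> has_initial_data u u0 ->
  (forall t, 0 < t <= T -> curvature_bounded_below c (u^~ t)) ->
  0 < t < T -> u0 x - c * n%:R * t <= u x t.
Proof.
move=> c0 su mu iu cu /andP[t0 tT]; apply/ler_addgt0Pl => e e0.
have near0 := initial_data_uniform iu (@compact_set1 _ x) e0.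
near (0 : R)^'+ => s.
have s0 : 0 < s by near: s; exact: nbhs_right_gt.
have st : s < t by near: s; exact: nbhs_right_lt.
have us : `|u0 x - u x s| < e by (have := near near0 s _; apply) => //.
have du r : 0 < r < T -> is_derive r (1 : R) (fun r => u x r + r * (c * n%:R))
     (dtime T u x r + c * n%:R).
  move=> r0T; have H : is_derive r (1 : R) (fun r => u x r + r * (c * n%:R)) _ :=
    is_deriveD (smooth_is_derive x su r0T)
    (is_deriveM (is_derive_id r (1 : R)) (is_derive_cst (c * n%:R) r (1 : R))).
  by apply: (is_derive_eq H); rewrite scaler0 add0r [_ *: 1]mulr1.
have [r] : exists2 r, r \in `]s, t[ &
    (u x t + t * (c * n%:R)) - (u x s + s * (c * n%:R)) =
    (dtime T u x r + c * n%:R) * (t - s).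
  apply: (@MVT _ (fun r => u x r + r * (c * n%:R)) _ _ _ st).
    move=> r; rewrite in_itv /= => /andP[sr rt]; apply: du.
    by rewrite (lt_trans s0 sr) (lt_trans rt tT).
  apply: derivable_within_continuous => r; rewrite in_itv /= => /andP[sr rt].
  have r0T : 0 < r < T by rewrite (lt_le_trans s0 sr) (le_lt_trans rt tT).
  by have [] := du _ r0T.
rewrite in_itv /= => /andP[sr rt] E.
have r0T : 0 < r <= T by rewrite (lt_trans s0 sr) ltW// (lt_trans rt tT).
have := mcf_speed_ge x mu r0T (cu _ r0T); rewrite mulNr => v0.
have : 0 <= (dtime T u x r + c * n%:R) * (t - s).
  by rewrite mulr_ge0 ?subr_ge0 ?(ltW st)//; lra.
rewrite -E; have : 0 <= s * (c * n%:R) by rewrite !mulr_ge0// ltW.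
move: us; rewrite ltr_norml => /andP[_ us]; lra.
Unshelve. all: by end_near. Qed.

End Flow.

(** * Closed balls *)

Section Balls.
Variables (R : realType) (n : nat).
Implicit Types (x y : 'rV[R]_n).

Lemma norm_le_enorm x : `|x| <= enorm x.
Proof.
have [->|x0] := eqVneq `|x| 0; first exact: sqrtr_ge0.
have [[i j] /= xE] := mx_norm_neq0 x0.
rewrite /Num.norm /= xE (ord1 i) -[leLHS]ger0_norm// -sqrtr_sqr ler_wsqrtr//.
rewrite real_normK ?num_real// (bigD1 j)//= lerDl.
by apply: sumr_ge0 => k _; exact: sqr_ge0.
Qed.

Lemma compact_closed_ball x (r : R) : 0 < r -> compact [set y | `|x - y| <= r].
Proof.
move=> r0; apply: bounded_closed_compact.
  exists (`|x| + r); split; first exact: num_real.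
  move=> M xrM y /= xy; rewrite -[y](subKr x).
  by rewrite (le_trans (ler_normB _ _))// (le_trans _ (ltW xrM))// lerD2l.
have <- : closed_ball x r = [set y | `|x - y| <= r] by rewrite closed_ballE.
exact: closed_ball_closed.
Qed.

End Balls.

(** * Comparison of two solutions *)

Section Comparison.
Variables (R : realType) (n : nat).
Implicit Types (x y : 'rV[R]_n).

Variables (T c : R).
Hypothesis c0 : 0 <= c.
Variables (u1 u2 : 'rV[R]_n -> R -> R).
Hypotheses (s1 : smooth T u1) (s2 : smooth T u2).
Hypotheses (m1 : graphical_mcf T u1) (m2 : graphical_mcf T u2).
Hypothesis k2 : forall t, 0 < t <= T -> curvature_bounded_below c (u2^~ t).

(* At most [exp (- u2)], hence small wherever [u2] is large, whatever the size
   of [u1] there. *)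
Let gap x t := expR (- u2 x t) - expR (- u1 x t).
(* Exceeds the constant [2 c + 1] of touching_speed_le, so that the conditions in
   space and in time at a positive maximum are contradictory. *)
Let rate := 2 * c + 2.
Let damped_gap x t := expR (- (rate * t)) * gap x t.

(** At a positive maximum, with [q = exp (u1 - u2) > 1], the first and second
    order conditions in space bound the time derivative of [u1] by
    [q] times that of [u2] plus [(2 c + 1) (q - 1)], whereas the condition in
    time makes it at least the same with [2 c + 2]. *)
Lemma gap_max_le0 x t : 0 < t < T ->
  (forall y, gap y t <= gap x t) ->
  (forall s, 0 < s < t -> damped_gap x s <= damped_gap x t) -> gap x t <= 0.
Proof.
move=> t0T xmax tmax; rewrite leNgt; apply/negP => gap0.
have t0T' : 0 < t <= T by case/andP: t0T => -> /ltW.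
have [t0 _] := andP t0T.
have := max_exp_diff (smooth_slice s1 t0T') (smooth_slice s2 t0T') xmax.
set q := expR _ => -[gq hq].
have q1 : 1 < q.
  by move: gap0; rewrite subr_gt0 ltr_expR ltrN2 /q -expR0 ltr_expR subr_gt0.
have := touching_speed_le c0 (ltW q1) (curvature_bound_hess (k2 t0T') x) hq.
rewrite -gq -(mcf_dtime x m1 t0T') -(mcf_dtime x m2 t0T').
move: (smooth_is_derive x s1 t0T) (smooth_is_derive x s2 t0T).
move: (dtime _ _ _ _) (dtime _ _ _ _) => l2 l1 d1 d2 l12.
have dr : is_derive t (1 : R) (fun s => rate * s) rate.
  have H : is_derive t (1 : R) (fun s => rate * s) _ :=
    is_deriveZ rate (is_derive_id t (1 : R)).
  by apply: (is_derive_eq H); rewrite [_ *: 1]mulr1.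
have dF : is_derive t (1 : R) (damped_gap x)
    (expR (- (rate * t)) * (l1 * expR (- u1 x t) - l2 * expR (- u2 x t) - rate * gap x t)).
  have H : is_derive t (1 : R) (damped_gap x) _ := is_deriveM (is_derive_expN dr)
    (is_deriveB (is_derive_expN d2) (is_derive_expN d1)).
  by apply: (is_derive_eq H); rewrite !fctE /gap /GRing.scale /=; ring.
have := left_max_derive_ge0 dF t0 tmax.
rewrite pmulr_rge0 ?expR_gt0// /gap.
have -> : expR (- u2 x t) = q * expR (- u1 x t).
  by rewrite /q -expRD; congr expR; ring.
have e0 := expR_gt0 (- u1 x t).
move: (expR (- u1 x t)) e0 => e e0.
have -> : l1 * e - l2 * (q * e) - rate * (q * e - e) =
  (l1 - (q * l2 + (2 * c + 1) * (q - 1)) - (q - 1)) * e by rewrite /rate; ring.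
rewrite pmulr_lge0//; lra.
Qed.

Lemma damped_gap_continuous (A : set ('rV[R]_n * R)) : A `<=` slab T ->
  {within A, continuous (fun p => damped_gap p.1 p.2)}.
Proof.
move=> AT; apply/subspace_continuousP => -[x t] Axt.
have cE u : smooth T u ->
    expR (- u p.1 p.2) @[p --> within A (nbhs (x, t))] --> expR (- u x t).
  move=> su; have [cu _] := su 0%N.
  have /subspace_continuousP /(_ _ Axt) cu' := continuous_subspaceW AT cu.
  apply: (@continuous_cvg _ _ _ _ _ (fun p => - u p.1 p.2) expR).
    exact: continuous_expR.
  exact: cvgN.
apply: cvgM; last by apply: cvgB; exact: cE.
apply: (@continuous_cvg _ _ _ _ _ (fun p => - (rate * p.2)) expR).
  exact: continuous_expR.
apply: cvgN; apply: cvgM; first exact: cvg_cst.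
by apply: cvg_within_filter; exact: cvg_snd.
Qed.

Variable u0 : 'rV[R]_n -> R.
Hypotheses (p0 : proper_graph u0).
Hypotheses (i1 : has_initial_data u1 u0) (i2 : has_initial_data u2 u0).

Lemma gap_lt_far e : 0 < e ->
  exists r, forall x t, 0 < t < T -> r < `|x| -> gap x t < e.
Proof.
move=> e0; have [r rP] := p0 (c * n%:R * T - ln e).
exists r => x t t0T rx; have u0x := rP x (lt_le_trans rx (norm_le_enorm x)).
rewrite /gap ltrBlDr -[X in expR X]opprK.
have -> : e = expR (ln e) by rewrite lnK.
apply: (@le_lt_trans _ _ (expR (ln e))); last by rewrite ltrDl expR_gt0.
rewrite ler_expR opprK.
have := mcf_lower_bound x c0 s2 m2 i2 k2 t0T.
have [t0 tT] := andP t0T.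
have : c * n%:R * t <= c * n%:R * T by rewrite ler_wpM2l ?mulr_ge0// ltW.
lra.
Qed.

(** [exp (- u2) - exp (- u1) <= exp (- u2) (u1 - u2)]: the last factor is small by
    uniform convergence to the common initial value, and the first is bounded
    because [u2] is continuous, hence bounded below, on [K] at one small time
    [s] and stays close to [u0] near time 0. *)
Lemma gap_lt_early (K : set 'rV[R]_n) e : 0 < T -> K !=set0 -> compact K -> 0 < e ->
  \forall t \near (0 : R)^'+, forall x, K x -> gap x t < e.
Proof.
move=> T0 K0 cK e0.
(* [u2 x0 s - 2] will bound [u2] from below on [K] at early times. *)
have near2 := initial_data_uniform i2 cK ltr01.
near (0 : R)^'+ => s.
have sT : 0 < s <= T.
  by apply/andP; split; near: s; [exact: nbhs_right_gt|exact: nbhs_right_le].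
have su : forall x, K x -> `|u0 x - u2 x s| < 1 by near: s; exact: near2.
have cu : {within K, continuous (u2^~ s)}.
  by apply: continuous_subspaceT; apply: (Ck0_slice sT); exact: (s2 0%N).
have [x0 _ x0min] := compact_EVT_min K0 cK cu.
pose d := Num.min 1 (e / expR (2 - u2 x0 s) / 2).
have d0 : 0 < d by rewrite lt_min ltr01 !divr_gt0// expR_gt0.
have n1 := initial_data_uniform i1 cK d0.
have n2 := initial_data_uniform i2 cK d0.
near=> t => x Kx.
have h1 : `|u0 x - u1 x t| < d by move: x Kx; near: t; exact: n1.
have h2 : `|u0 x - u2 x t| < d by move: x Kx {h1}; near: t; exact: n2.
have d1 : d <= 1 by rewrite ge_min lexx.
have d2 : d <= e / expR (2 - u2 x0 s) / 2 by rewrite ge_min lexx orbT.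
have l2 : u2 x0 s - 2 <= u2 x t.
  have := x0min x (mem_set Kx); have := su x Kx.
  by move: h2; rewrite !ltr_norml => /andP[_ h2] /andP[h3 _]; lra.
have d12 : u1 x t - u2 x t < 2 * d.
  by move: h1 h2; rewrite !ltr_norml => /andP[h1 _] /andP[_ h2]; lra.
have -> : gap x t = expR (- u2 x t) * (1 - expR (u2 x t - u1 x t)).
  rewrite mulrBr mulr1 -expRD /gap; congr (_ - expR _); ring.
have E := expR_ge1Dx (u2 x t - u1 x t).
apply: (@le_lt_trans _ _ (expR (- u2 x t) * (u1 x t - u2 x t))).
  by move: (expR (u2 x t - u1 x t)) E => z E; rewrite ler_pM2l ?expR_gt0//; lra.
apply: (@lt_le_trans _ _ (expR (- u2 x t) * (2 * d))).
  by rewrite ltr_pM2l ?expR_gt0.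
apply: (@le_trans _ _ (expR (2 - u2 x0 s) * (2 * d))).
  by rewrite ler_pM2r ?mulr_gt0// ler_expR; lra.
rewrite mulrC -ler_pdivlMr ?expR_gt0//; lra.
Unshelve. all: by end_near. Qed.

(** A positive value of the damped gap exceeds all its values far away and at
    early times, so its supremum up to time [t] is attained, at a positive time,
    where gap_max_le0 applies. *)
Lemma mcf_comparison x t : 0 < t < T -> u1 x t <= u2 x t.
Proof.
move=> t0T; have [t0 tT] := andP t0T.
suff : gap x t <= 0 by rewrite subr_le0 ler_expR lerN2.
rewrite leNgt; apply/negP => gap0.
have rate0 : 0 < rate by rewrite /rate ltr_wpDl// mulr_ge0.
pose e := damped_gap x t; have e0 : 0 < e by rewrite mulr_gt0// expR_gt0.
have lt_damped y s : 0 < s -> gap y s < e -> damped_gap y s < e.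
  move=> s0 ge; have [g0|g0] := leP (gap y s) 0.
    by rewrite (le_lt_trans _ e0)// mulr_ge0_le0// ltW// expR_gt0.
  rewrite (le_lt_trans _ ge)// ler_piMl ?(ltW g0)// -expR0 ler_expR.
  by rewrite oppr_le0 mulr_ge0// ltW.
have [r rP] := gap_lt_far e0.
pose rho := Num.max 1 (Num.max r `|x|).
have rho0 : 0 < rho by rewrite lt_max ltr01.
pose K : set 'rV[R]_n := [set y | `|0 - y| <= rho].
have cK : compact K := compact_closed_ball rho0.
have Kx : K x by rewrite /K /= sub0r normrN !le_max lexx !orbT.
have T0 : 0 < T := lt_trans t0 tT.
have K0 : K !=set0 by exists x.
have nK := gap_lt_early T0 K0 cK e0.
near (0 : R)^'+ => s.
have s0 : 0 < s by near: s; exact: nbhs_right_gt.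
have st : s < t by near: s; exact: nbhs_right_lt.
have early : forall r, 0 < r < s -> forall y, K y -> gap y r < e.
  near: s; move: nK => [d /= d0 dP]; exists d => //= s /=.
  rewrite sub0r normrN => sd s0 r' /andP[r0 rs]; apply: dP => //=.
  by rewrite sub0r normrN gtr0_norm// (lt_trans rs)// (le_lt_trans _ sd)// ler_norm.
have cC : compact (K `*` `[s, t]) by apply: compact_setX => //; exact: segment_compact.
have CT : K `*` `[s, t] `<=` slab T.
  move=> [y r'] [_ /=]; rewrite in_itv /= => /andP[sr rt].
  by rewrite /slab /= (lt_le_trans s0 sr) (le_trans rt (ltW tT)).
have Cxt : (K `*` `[s, t]) (x, t) by split => //=; rewrite in_itv /= lexx ltW.
have C0 : K `*` `[s, t] !=set0 by exists (x, t).
have [[y r'] yrC yrmax] := compact_EVT_max C0 cC (damped_gap_continuous CT).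
move: yrC; rewrite inE => -[/= Ky]; rewrite in_itv /= => /andP[sr rt].
have le_damped : e <= damped_gap y r' by have := yrmax (x, t) (mem_set Cxt).
have damped_max z q : 0 < q <= t -> damped_gap z q <= damped_gap y r'.
  move=> /andP[q0 qt]; have [Kz|Kz] := leP `|0 - z| rho.
    have [sq|qs] := leP s q.
      have zq : (K `*` `[s, t]) (z, q) by split => //=; rewrite in_itv /= sq.
      exact: (yrmax (z, q) (mem_set zq)).
    by apply: le_trans le_damped; apply/ltW/lt_damped => //; apply: (early q); rewrite ?q0.
  apply: le_trans le_damped; apply/ltW/lt_damped => //; apply: rP.
    by rewrite q0 (le_lt_trans qt).
  by move: Kz; rewrite sub0r normrN; apply: le_lt_trans; rewrite !le_max lexx !orbT.
have r0 : 0 < r' := lt_le_trans s0 sr.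
have := @gap_max_le0 y r'; rewrite r0 (le_lt_trans rt tT) => /(_ isT).
have gpos : 0 < gap y r'.
  by move: (lt_le_trans e0 le_damped); rewrite pmulr_rgt0// expR_gt0.
rewrite leNgt gpos => H; suff : false by []; apply: H.
- move=> z; have := damped_max z r'; rewrite r0 rt => /(_ isT).
  by rewrite ler_pM2l// expR_gt0.
- move=> q /andP[q0 qr]; apply: damped_max; rewrite q0 (le_trans (ltW qr))//.
Unshelve. all: by end_near. Qed.

End Comparison.

Unset Implicit Arguments.

Theorem theorem1p3 (R : realType) (n : nat) (T : R)
    (u0 : 'rV[R]_n -> R) (u1 u2 : 'rV[R]_n -> R -> R) (c : R) :
  (1 <= n)%N -> 0 < T ->
  [locally [lipschitz u0 x | x in [set: 'rV[R]_n]]] ->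
  proper_graph u0 ->
  smooth T u1 -> smooth T u2 ->
  graphical_mcf T u1 -> graphical_mcf T u2 ->
  has_initial_data u1 u0 -> has_initial_data u2 u0 ->
  0 < c ->
  (forall t, 0 < t <= T -> curvature_bounded_below c (u1^~ t)) ->
  (forall t, 0 < t <= T -> curvature_bounded_below c (u2^~ t)) ->
  forall x t, 0 < t <= T -> u1 x t = u2 x t.
Proof.
move=> _ T0 _ p0 s1 s2 m1 m2 i1 i2 c0 k1 k2 x.
have before t : 0 < t < T -> u1 x t = u2 x t.
  move=> tT; apply/eqP; rewrite eq_le.
  rewrite (mcf_comparison (ltW c0) s1 s2 m1 m2 k2 p0 i1 i2 x tT).
  by rewrite (mcf_comparison (ltW c0) s2 s1 m2 m1 k1 p0 i2 i1 x tT).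
move=> t /andP[t0]; rewrite le_eqVlt => /orP[/eqP ->|tT]; last first.
  by apply: before; rewrite t0.
have c1 := @Ck0_left_limit _ _ _ u1 x T0 (s1 0%N).
have c2 := @Ck0_left_limit _ _ _ u2 x T0 (s2 0%N).
apply: (cvg_unique _ c1) => //; apply: cvg_trans c2; apply: near_eq_cvg.
near=> s; apply/esym/before/andP; split; near: s.
  exact: nbhs_left_gt.
exact: nbhs_left_lt.
Unshelve. all: by end_near. Qed.
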